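(* Let $K$ be a field and $R=K[X_1,\dots,X_n]$, $n\ge 1$. Let $\mathfrak a_\bullet=\{\mathfrak a_m\}_{m\in\mathbb N}$ be a graded sequence of ideals in $R$ supported at the origin. Let $>$ be a monomial order on the monomials of $R$, and put $\mathfrak a'_m=\operatorname{in}_>(\mathfrak a_m)$ for all $m$. Then $\mathrm e(\mathfrak a_\bullet)=\mathrm e(\mathfrak a'_\bullet)$. In particular, for every ideal $I\subset R$ supported at the origin, $\mathrm e(I)=\lim_{m\to\infty}\mathrm e(\operatorname{in}_>(I^m))/m^n$.
   Context: $\mathbb N$ includes $0$. An ideal of $R$ is supported at the origin if it contains a power of $(X_1,\dots,X_n)$; the unit ideal is allowed. A graded sequence of ideals is a family $\{\mathfrak a_m\}_{m\in\mathbb N}$ with $\mathfrak a_p\mathfrak a_q\subseteq\mathfrak a_{p+q}$ for all $p,q\in\mathbb N$. A monomial order is a total order on monomials, compatible with multiplication, with $1$ smallest. $\operatorname{in}_>(J)$ is the ideal generated by the initial monomials of elements of $J$. $\mathrm e(J)$ is the Hilbert–Samuel multiplicity of the localization of $R$ at the origin along $J$, with $\mathrm e(R)=0$, and $\mathrm e(\mathfrak a_\bullet)=\lim_{m\to\infty}\mathrm e(\mathfrak a_m)/m^n$; this limit exists for graded sequences. *)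

(* Defs.v *)
From HB Require Import structures.
From mathcomp Require Import all_boot all_order all_algebra.
From mathcomp Require Import boolp classical_sets.
From mathcomp Require mpoly.
Set Implicit Arguments.
Unset Strict Implicit.
Unset Printing Implicit Defensive.
Import Order.TTheory GRing.Theory Num.Theory.
Local Open Scope classical_set_scope.
Local Open Scope ring_scope.

Section Ideals.
Variable A : comNzRingType.
Implicit Types I J : set A.

(* [ring_quotient.idealr_closed] only describes proper ideals, whereas the unit
   ideal has to be allowed here. *)
Definition is_ideal I : Prop :=
  [/\ I 0, (forall x y, I x -> I y -> I (x + y))
    & (forall c x, I x -> I (c * x))].

Definition ideal_gen (S : set A) : set A := smallest is_ideal S.

Definition ideal_mul I J : set A := ideal_gen [set x * y | x in I & y in J].

Definition ideal_exp I (k : nat) : set A := iter k (ideal_mul I) [set: A].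

Definition graded_sequence (a : nat -> set A) : Prop :=
  (forall m, is_ideal (a m)) /\
  (forall p q, ideal_mul (a p) (a q) `<=` a (p + q)%N).

(* A strict chain of k + 1 submodules of A / I; the submodules of A / I are
   identified with the ideals of A that contain I. *)
Definition quotient_chain I (k : nat) (c : nat -> set A) : Prop :=
  [/\ (forall i, (i <= k)%N -> is_ideal (c i)), I `<=` c 0%N
    & (forall i, (i < k)%N -> c i `<` c i.+1)].

End Ideals.

(* The notations of mpoly cannot coexist with those of the topology library;
   importing mpoly inside a module keeps them local to it. *)
Module Export PolynomialRing.
Import mpoly.

Section Origin.
Variables (K : fieldType) (n : nat).
Local Notation P := {mpoly K[n]}.
Local Notation "x %:F" := (FracField.tofrac (x : P)).

Definition origin_ideal : set P := ideal_gen [set 'X_i | i in [set: 'I_n]].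

Definition supported_at_origin (J : set P) : Prop :=
  exists k, ideal_exp origin_ideal k `<=` J.

Definition regular_at_origin : {pred {fraction P}} :=
  fun x => `[< exists f g : P, g.@[fun=> 0] != 0 /\ x = f%:F / g%:F >].

Lemma regular_at_origin_subring : subring_closed regular_at_origin.
Proof.
have nz (g : P) : g.@[fun=> 0] != 0 -> g%:F != 0.
  by move=> g0; rewrite tofrac_eq0; apply: contraNneq g0 => ->; rewrite meval0.
split.
- apply/asboolP; exists 1, 1; split; first by rewrite meval1 oner_neq0.
  by rewrite tofrac1 divr1.
- move=> _ _ /asboolP[f [g [g0 ->]]] /asboolP[f' [g' [g'0 ->]]].
  apply/asboolP; exists (f * g' - f' * g), (g * g'); split.
    by rewrite mevalM mulf_neq0.
  by rewrite -mulNr addf_div ?nz // tofracB !tofracM mulNr.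
- move=> _ _ /asboolP[f [g [g0 ->]]] /asboolP[f' [g' [g'0 ->]]].
  apply/asboolP; exists (f * f'), (g * g'); split.
    by rewrite mevalM mulf_neq0.
  by rewrite !tofracM mulf_div.
Qed.

HB.instance Definition _ := GRing.isSubringClosed.Build {fraction P}
  regular_at_origin regular_at_origin_subring.

(* The localization of K[X_1, ..., X_n] at (X_1, ..., X_n), as a subring of the
   field of fractions. *)
Record local_ring := LocalRing {
  local_frac :> {fraction P};
  _ : local_frac \in regular_at_origin }.

HB.instance Definition _ := [isSub for local_frac].
HB.instance Definition _ := [Choice of local_ring by <:].
HB.instance Definition _ :=
  [SubChoice_isSubComNzRing of local_ring by <:].

Definition localize (J : set P) : set local_ring :=
  ideal_gen [set x : local_ring | exists2 f, J f & \val x = f%:F].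

Definition monomial_order (le : rel 'X_{1..n}) : Prop :=
  [/\ total le, antisymmetric le, transitive le,
      (forall m m1 m2, le m1 m2 -> le (m + m1)%MM (m + m2)%MM)
    & (forall m, le 0%MM m)].

Definition initial_monomial (le : rel 'X_{1..n}) (f : P) (m : 'X_{1..n}) :
    Prop :=
  m \in msupp f /\ (forall m', m' \in msupp f -> le m' m).

Definition initial_ideal (le : rel 'X_{1..n}) (J : set P) : set P :=
  ideal_gen [set 'X_[m] | m in
    [set m | exists2 f, J f & initial_monomial le f m]].

End Origin.
End PolynomialRing.

From mathcomp Require Import reals constructive_ereal ereal topology.
From mathcomp Require Import normedtype sequences.
Import numFieldNormedType.Exports.

Section Multiplicity.
Variable R : realType.

(* The length of the A-module A / I, equal to +oo if it is not finite. *)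
Definition quotient_length (A : comNzRingType) (I : set A) : \bar R :=
  ereal_sup [set (k%:R)%:E | k in [set k | exists c, quotient_chain I k c]].

(* Hilbert-Samuel multiplicity of I in a ring of dimension d. *)
Definition hilbert_samuel (A : comNzRingType) (d : nat) (I : set A) : R :=
  limn (fun t : nat =>
    d`!%:R * fine (quotient_length (ideal_exp I t)) / t%:R ^+ d).

(* The localization of K[X_1, ..., X_n] at the origin has dimension n. *)
Definition mult (K : fieldType) (n : nat) (J : set (mpoly.mpoly n K)) : R :=
  hilbert_samuel n (localize J).

Definition mult_seq (K : fieldType) (n : nat)
    (a : nat -> set (mpoly.mpoly n K)) : nat -> R :=
  fun m => mult (a m) / m%:R ^+ n.

Definition asymptotic_mult (K : fieldType) (n : nat)
    (a : nat -> set (mpoly.mpoly n K)) : R :=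
  limn (mult_seq a).

End Multiplicity.

(* Main.v *)
(* Let [l(J)] be the number of monomials that are not initial monomials of
   elements of [J]; it is the length of the localization of [K[X] / J], because
   ideals [J <= J'] with the same initial monomials are equal, and because an
   ideal [J != R] can be enlarged by a line. For a graded sequence [a], write an
   exponent vector as [u = t v + rest] with [t = N / m]: if [v] is an initial
   monomial of [a m] then [u] is one of [a N], up to boundary terms.
   Hence [l(a N) / N ^ n <= l(a m) / m ^ n + O(1 / N)], and [l(a m) / m ^ n]
   converges to its infimum [L]. For the powers of [J = a m] this yields that
   [e(J)] exists and Lech's inequality [e(J) <= n! l(J)]; with
   [(a m) ^ t <= a (m t)] it follows that
   [n! L <= e(a m) / m ^ n <= n! l(a m) / m ^ n], so [e(a m) / m ^ n] tends to
   [n! L]. Since [l(a m)] does not change when [a m] is replaced by its initial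
   ideal, neither does the limit. *)
Require Import Defs.
From mathcomp Require Import all_boot all_order all_algebra.
From mathcomp Require Import finmap ring.
From mathcomp Require Import boolp classical_sets cardinality.
From mathcomp Require mpoly.
Set Implicit Arguments.
Unset Strict Implicit.
Unset Printing Implicit Defensive.
Import Order.TTheory GRing.Theory Num.Theory.
Local Open Scope classical_set_scope.
Local Open Scope ring_scope.

(** * Products and powers of ideals *)

Section Ideals.
Variable A : comNzRingType.
Implicit Types I J L S : set A.

Lemma ideal_gen_ideal S : is_ideal (ideal_gen S).
Proof.
split=> [M [[]]//|x y Sx Sy M SM|c x Sx M SM].
  by case: (SM) => -[_ MD _] _; apply: MD; [apply: Sx|apply: Sy].
by case: (SM) => -[_ _ MZ] _; apply: MZ; apply: Sx.
Qed.

Lemma ideal_mul_ideal I J : is_ideal (ideal_mul I J).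
Proof. exact: ideal_gen_ideal. Qed.

Lemma mem_ideal_mul I J x y : I x -> J y -> ideal_mul I J (x * y).
Proof. by move=> Ix Jy; apply: sub_gen_smallest; exists x => //; exists y. Qed.

Lemma ideal_mul_sub I J L : is_ideal L ->
  (forall x y, I x -> J y -> L (x * y)) -> ideal_mul I J `<=` L.
Proof.
by move=> Li IJL; apply: smallest_sub => // _ [x Ix [y Jy <-]]; apply: IJL.
Qed.

(** The colon ideal (L : J). It turns a statement about products into membership of the first
    factor, to which [ideal_mul_sub] applies. *)
Lemma ideal_colon J L : is_ideal L ->
  is_ideal [set x | forall y, J y -> L (x * y)].
Proof.
case=> L0 LD LZ; split=> [y _|x x' Hx Hx' y Jy|c x Hx y Jy] /=.
- by rewrite mul0r.
- by rewrite mulrDl; apply: LD; [apply: Hx|apply: Hx'].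
- by rewrite -mulrA; apply: LZ; apply: Hx.
Qed.

Lemma ideal_exp_ideal I t : is_ideal (ideal_exp I t).
Proof. by case: t => [//|t]; apply: ideal_mul_ideal. Qed.

Lemma ideal_expD I p q :
  ideal_mul (ideal_exp I p) (ideal_exp I q) `<=` ideal_exp I (p + q).
Proof.
apply: ideal_mul_sub; first exact: ideal_exp_ideal.
elim: p => [|p IHp] x y /=.
  by move=> _ Iy; have [_ _ Z] := ideal_exp_ideal I q; apply: Z.
move=> Ix Iy; move: x Ix y Iy; apply: ideal_mul_sub.
  exact/ideal_colon/ideal_mul_ideal.
move=> a b Ia Ib y Iy; rewrite -mulrA.
by apply: mem_ideal_mul => //; apply: IHp.
Qed.

Lemma ideal_exp1 I : is_ideal I -> ideal_exp I 1 = I.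
Proof.
move=> [I0 ID IZ]; apply/seteqP; split=> [|x Ix] /=.
  by apply: ideal_mul_sub => // x y Ix _; rewrite mulrC; apply: IZ.
by rewrite -[x]mulr1; apply: mem_ideal_mul.
Qed.

Lemma graded_ideal_exp I : graded_sequence (ideal_exp I).
Proof. by split=> [m|p q]; [apply: ideal_exp_ideal|apply: ideal_expD]. Qed.

(** For [t = 0] the left side is the unit ideal, while [a 0] may be proper; hence [0 < t]. *)
Lemma graded_exp_sub (a : nat -> set A) m t : graded_sequence a -> (0 < t)%N ->
  ideal_exp (a m) t `<=` a (m * t)%N.
Proof.
move=> [ai aM]; case: t => // t _; elim: t => [|t IHt].
  by rewrite ideal_exp1 ?muln1.
rewrite [X in X `<=` _]/= mulnS.
apply: ideal_mul_sub => // x y ax ay; apply: aM; apply: mem_ideal_mul => //.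
exact: IHt.
Qed.

Lemma idealB I x y : is_ideal I -> I x -> I y -> I (x - y).
Proof.
by case=> _ ID IZ Ix Iy; apply: ID => //; rewrite -mulN1r; apply: IZ.
Qed.

Lemma idealMr I x y : is_ideal I -> I x -> I (x * y).
Proof. by case=> _ _ IZ Ix; rewrite mulrC; apply: IZ. Qed.

End Ideals.

(** * Cardinalities of finite sets *)

(** [fset_set] sends an infinite set to the empty one, so the value is meaningful only for finite
    [B]. *)
Definition ncard (T : choiceType) (B : set T) : nat := #|` fset_set B|.

Lemma ncard_sub (T : choiceType) (B C : set T) :
  finite_set C -> B `<=` C -> (ncard B <= ncard C)%N.
Proof.
move=> fC BC; have fB := sub_finite_set BC fC.
by apply: fsubset_leq_card; move: BC; rewrite fset_set_sub.
Qed.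

Lemma ncard_proper (T : choiceType) (B C : set T) :
  finite_set C -> B `<` C -> (ncard B < ncard C)%N.
Proof.
move=> fC [BC CB]; have fB := sub_finite_set BC fC.
apply: fproper_ltn_card; rewrite fproperE.
by move: BC CB; rewrite !fset_set_sub // => -> /negP.
Qed.

Lemma ncardU1 (T : choiceType) (x : T) (B : set T) :
  finite_set B -> (ncard (x |` B) <= (ncard B).+1)%N.
Proof.
move=> fB; rewrite /ncard fset_setU1 // cardfsU1.
by rewrite -add1n leq_add2r leq_b1.
Qed.

(** Each strict inclusion removes at least one element from the finite complement. *)
Lemma chain_ncard (T : choiceType) (B : nat -> set T) k :
  finite_set (~` B 0%N) -> (forall i, (i < k)%N -> B i `<` B i.+1) ->
  (k <= ncard (~` B 0%N))%N.
Proof.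
move=> f0 Bs; suff H i : (i <= k)%N ->
  finite_set (~` B i) /\ (i + ncard (~` B i) <= ncard (~` B 0%N))%N.
  by have [_ ] := H k (leqnn k); apply: leq_trans; rewrite leq_addr.
elim: i => [//|i IHi] ik; have [fi ci] := IHi (ltnW ik).
have [s1 s2] := Bs i ik.
have S : ~` B i.+1 `<=` ~` B i by apply: subsetC.
split; first exact: sub_finite_set fi.
apply: leq_trans ci; rewrite addSn -addnS leq_add2l.
by apply: ncard_proper => //; split => // /subsetC; rewrite !setCK.
Qed.

Lemma ncardU (T : choiceType) (B C : set T) : finite_set B -> finite_set C ->
  (ncard (B `|` C) <= ncard B + ncard C)%N.
Proof. by move=> fB fC; rewrite /ncard fset_setU // cardfsU leq_subr. Qed.

Lemma ncard_range (T : choiceType) (F : finType) (phi : F -> T) (B : set T) :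
  B `<=` range phi -> (ncard B <= #|F|)%N.
Proof.
move=> Bphi.
have fphi : finite_set (range phi) by exact/finite_image/finite_finset.
apply: (leq_trans (ncard_sub fphi Bphi)).
have -> : ncard (range phi) = #|` [fset phi x | x in F]%fset|.
  congr (#|` _|); apply/fsetP => y; rewrite in_fset_set //.
  apply/idP/imfsetP => [|[x _ ->]]; rewrite inE; last by exists x.
  by case=> x _ <-; exists x.
by apply: leq_trans (leq_imfset_card _ _ _) _; rewrite -cardE.
Qed.

Module Export Polynomials.
Import mpoly.

(** * Monomials and their degrees *)

Section Monomials.
Variable n : nat.
Implicit Types u v w : 'X_{1..n}.

Lemma mnm_neq0 u : u != 0%MM -> exists i, u i != 0%N.
Proof.
move=> u0; apply/existsP; apply: contraNT u0 => /existsPn u0.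
by apply/eqP/mnmP => i; rewrite mnm0E; apply/eqP; move: (u0 i); rewrite negbK.
Qed.

Lemma mnm_divide u k : (k <= mdeg u)%N ->
  exists v w, u = (v + w)%MM /\ mdeg v = k.
Proof.
elim: k => [|k IHk] ku; first by exists 0%MM, u; rewrite add0m mdeg0.
have [v [w [uE vk]]] := IHk (ltnW ku).
have : (0 < mdeg w)%N by move: ku; rewrite uE mdegD vk -addn1 leq_add2l.
rewrite lt0n mdeg_eq0 => /mnm_neq0[i wi].
exists (v + U_(i))%MM, (w - U_(i))%MM; split; last first.
  by rewrite mdegD mdeg1 vk addn1.
by rewrite uE -addmA [(U_(_) + _)%MM]addmC submK // lep1mP.
Qed.

Lemma finite_mdeg_lt k : finite_set [set u : 'X_{1..n} | (mdeg u < k)%N].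
Proof.
apply: (@sub_finite_set _ _ [set bmnm m | m in [set: 'X_{1..n < k}]]).
  move=> u uk.
  by exists (BMultinom uk).
exact/finite_image/finite_finset.
Qed.

End Monomials.

(** * Initial monomials and standard monomials *)

Section InitialMonomials.
Variables (K : fieldType) (n : nat) (le : rel 'X_{1..n}).
Hypothesis le_order : monomial_order le.
Local Notation P := {mpoly K[n]}.
Implicit Types (J : set P) (f g : P) (u v w : 'X_{1..n}).

(** The form in which support at the origin is used: for an ideal [J] it says that [J] contains the
    [k]-th power of the origin ideal. *)
Definition cofinite_at k J : Prop := forall u, (k <= mdeg u)%N -> J 'X_[u].

(** The complement of this set of exponents consists of the standard monomials of [J], which are the
    ones to be counted. *)
Definition initials J : set 'X_{1..n} :=
  [set m | exists2 f, J f & initial_monomial le f m].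

Let le_refl u : le u u.
Proof. by have [/(_ u u)] := le_order; rewrite orbb. Qed.

Let le_anti u v : le u v -> le v u -> u = v.
Proof. by move=> uv vu; have [_ + _ _ _] := le_order; apply; rewrite uv. Qed.

Let le_trans u v w : le u v -> le v w -> le u w.
Proof. by have [_ _ + _ _] := le_order; apply. Qed.

Lemma le_addl u v w : le v w -> le (u + v)%MM (u + w)%MM.
Proof. by have [_ _ _ + _] := le_order; apply. Qed.

Lemma exists_max (s : seq 'X_{1..n}) : s != [::] ->
  exists2 m, m \in s & forall u, u \in s -> le u m.
Proof.
have [tot _ _ _ _] := le_order.
elim: s => [//|x [|y s] IHs] _.
  by exists x; rewrite ?mem_head // => u; rewrite inE => /eqP ->.
have [//|m ms mP] := IHs.
have /orP[xm|mx] := tot x m.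
  by exists m => [|u]; rewrite inE ?ms ?orbT // => /predU1P[->|/mP].
exists x => [|u]; rewrite ?mem_head // inE => /predU1P[->//|/mP um].
exact: le_trans mx.
Qed.

Lemma initial_exists f : f != 0 -> exists m, initial_monomial le f m.
Proof. by rewrite -msupp_eq0 => /exists_max[m mf mP]; exists m. Qed.

Lemma initial_mul f g u v :
  initial_monomial le f u -> initial_monomial le g v ->
  initial_monomial le (f * g) (u + v)%MM.
Proof.
move=> [uf uP] [vg vP]; split; last first.
  move=> w /msuppM_le /allpairsP[[a b] /= [af bg ->]].
  apply: (@le_trans _ (u + b)%MM); last exact/le_addl/vP.
  by rewrite ![(_ + b)%MM]addmC; apply/le_addl/uP.
(* Only the pair [(u, v)] contributes to the coefficient at [u + v], which is therefore a product of
   two nonzero coefficients. *)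
have E a b : a \in msupp f -> b \in msupp g -> (u + v = a + b)%MM ->
    a = u /\ b = v.
  move=> af bg e.
  have h1 : (u + b = a + b)%MM.
    apply: le_anti; first by rewrite -e; apply/le_addl/vP.
    by rewrite ![(_ + b)%MM]addmC; apply/le_addl/uP.
  have ua : u = a by rewrite -[u](addmK b) h1 addmK.
  by split=> //; rewrite -[b](addmK a) addmC -e ua addmC addmK.
rewrite mcoeff_msupp mcoeffM.
have bu : (mdeg u < (mdeg (u + v)).+1)%N by rewrite ltnS mdegD leq_addr.
have bv : (mdeg v < (mdeg (u + v)).+1)%N by rewrite ltnS mdegD leq_addl.
rewrite (bigD1 (BMultinom bu, BMultinom bv)) /= ?eqxx //.
rewrite big1 ?addr0 ?mulf_neq0 -?mcoeff_msupp // => -[a b] /= /andP[/eqP e ne].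
have [af|/memN_msupp_eq0 ->] := boolP (bmnm a \in msupp f);
  last by rewrite mul0r.
have [bg|/memN_msupp_eq0 ->] := boolP (bmnm b \in msupp g);
  last by rewrite mulr0.
have [au bv'] := E _ _ af bg e.
by case/negP: ne; rewrite xpair_eqE -!val_eqE /= au bv' !eqxx.
Qed.

Lemma initialX u : initial_monomial le ('X_[u] : P) u.
Proof. by split=> [|v]; rewrite msuppX inE // => /eqP ->. Qed.

Lemma ideal_sum J f : is_ideal J ->
  (forall u, u \in msupp f -> J 'X_[u]) -> J f.
Proof.
move=> [J0 JD JZ] Jf; rewrite [f]mpolyE big_seq.
by apply: (big_ind J) => // u uf; rewrite -mul_mpolyC; apply/JZ/Jf.
Qed.

Lemma initials_up J u v : is_ideal J -> initials J u -> initials J (u + v)%MM.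
Proof.
move=> [_ _ JZ] [f Jf fu]; exists (f * 'X_[v]).
  by rewrite mulrC; apply: JZ.
exact/initial_mul/initialX.
Qed.

Lemma initials_mul I J L u v : ideal_mul I J `<=` L ->
  initials I u -> initials J v -> initials L (u + v)%MM.
Proof.
move=> IJL [f If fu] [g Jg gv]; exists (f * g); last exact: initial_mul.
by apply: IJL; apply: mem_ideal_mul.
Qed.

Lemma initials_cofinite k J u :
  cofinite_at k J -> (k <= mdeg u)%N -> initials J u.
Proof. by move=> Jk ku; exists 'X_[u]; [apply: Jk|apply: initialX]. Qed.

Lemma finite_standard k J : cofinite_at k J -> finite_set (~` initials J).
Proof.
move=> Jk; apply: sub_finite_set (@finite_mdeg_lt n k) => u /= Ju.
by rewrite ltnNge; apply/negP => /(initials_cofinite Jk).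
Qed.

Lemma initials_sub I J : I `<=` J -> initials I `<=` initials J.
Proof. by move=> IJ u [f /IJ Jf fu]; exists f. Qed.

(** The set [initials J] is closed under multiplication by monomials, so the polynomials supported
    on it already form an ideal. *)
Lemma initial_idealP J f : is_ideal J ->
  initial_ideal le J f <-> (forall u, u \in msupp f -> initials J u).
Proof.
move=> Ji; split; last first.
  move=> H; apply: ideal_sum; first exact: ideal_gen_ideal.
  by move=> u /H Ju; apply: sub_gen_smallest; exists u.
suff : initial_ideal le J `<=` [set g | {in msupp g, forall u, initials J u}].
  by apply.
apply: smallest_sub.
  split=> [u|g h Hg Hh u|c g Hg u] /=; first by rewrite msupp0.
    by move=> /msuppD_le; rewrite mem_cat => /orP[/Hg|/Hh].
  move=> /msuppM_le /allpairsP[[x y] /= [_ /Hg Jy ->]].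
  by rewrite addmC; apply: initials_up.
by move=> _ [u Ju <-] v; rewrite msuppX inE => /eqP ->.
Qed.

Lemma initials_initial_ideal J : is_ideal J ->
  initials (initial_ideal le J) = initials J.
Proof.
move=> Ji; apply/seteqP; split=> [u [f /(initial_idealP _ Ji) Jf [uf _]]|u Ju].
  exact: Jf.
exists 'X_[u]; last exact: initialX.
by apply/initial_idealP => // v; rewrite msuppX inE => /eqP ->.
Qed.

Lemma initial_ideal_mul I J L : is_ideal I -> is_ideal J -> is_ideal L ->
  ideal_mul I J `<=` L ->
  ideal_mul (initial_ideal le I) (initial_ideal le J) `<=` initial_ideal le L.
Proof.
move=> Ii Ji Li IJL; apply: ideal_mul_sub; first exact: ideal_gen_ideal.
move=> f g /(initial_idealP _ Ii) If /(initial_idealP _ Ji) Jg.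
apply/initial_idealP => // u /msuppM_le /allpairsP[[a b] /= [/If Ia /Jg Jb ->]].
exact: initials_mul Ia Jb.
Qed.

Lemma cofinite_initial_ideal k J : is_ideal J ->
  cofinite_at k J -> cofinite_at k (initial_ideal le J).
Proof.
move=> Ji Jk u ku; apply/initial_idealP => // v; rewrite msuppX inE => /eqP ->.
exact: initials_cofinite ku.
Qed.

(** A monomial of degree at least [k + l] has a divisor of degree exactly [k], and the cofactor has
    degree at least [l]. *)
Lemma cofinite_mul k l I J : cofinite_at k I -> cofinite_at l J ->
  cofinite_at (k + l) (ideal_mul I J).
Proof.
move=> Ik Jl u klu.
have [v [w [uE vk]]] := mnm_divide (leq_trans (leq_addr l k) klu).
rewrite uE mpolyXD; apply: mem_ideal_mul; first by apply: Ik; rewrite vk.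
by apply: Jl; move: klu; rewrite uE mdegD vk leq_add2l.
Qed.

Lemma cofinite_exp k J t :
  cofinite_at k J -> cofinite_at (k * t) (ideal_exp J t).
Proof.
move=> Jk; elim: t => [|t IHt]; first by [].
by rewrite mulnS; apply: cofinite_mul.
Qed.

Lemma supported_cofinite J : supported_at_origin J -> exists k, cofinite_at k J.
Proof.
have O1 : cofinite_at 1 (@origin_ideal K n).
  move=> u /mnm_divide[v [w [-> /eqP/mdeg1P[i /eqP ->]]]].
  rewrite mpolyXD; apply: (@idealMr _ (@origin_ideal K n)).
    exact: ideal_gen_ideal.
  by apply: sub_gen_smallest; exists i.
by move=> [k kJ]; exists k => u ku; apply/kJ/(cofinite_exp O1); rewrite mul1n.
Qed.

(* Subtracting multiples of elements of [I] lowers the initial monomial, and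
   below degree [k] only finitely many monomials lie below a given one. *)
Lemma initials_inj k I J : is_ideal I -> is_ideal J -> cofinite_at k I ->
  I `<=` J -> initials J `<=` initials I -> J `<=` I.
Proof.
move=> Ii Ji Ik IJ inJI.
have [_ JD JZ] := Ji; have [_ ID IZ] := Ii.
(* Modulo [I] a polynomial equals its part of degree below [k]. *)
have trunc f : exists2 g, I (f - g) & forall u,
    g@_u = if (mdeg u < k)%N then f@_u else 0.
  pose F u := if (mdeg u < k)%N then f@_u else 0.
  exists (\sum_(u <- msupp f | (mdeg u < k)%N) f@_u *: 'X_[u]).
    rewrite {1}[f]mpolyE (bigID (fun u => (mdeg u < k)%N)) /=.
    rewrite addrAC subrr add0r.
    apply: (big_ind I) => // [|u]; first by case: Ii.
    by rewrite -leqNgt -mul_mpolyC => /Ik; apply: IZ.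
  move=> u; rewrite raddf_sum /=.
  transitivity (\sum_(v <- msupp f) (f@_v * (v == u)%:R *+ (mdeg v < k)%N)).
    rewrite big_mkcond; apply: eq_bigr => v _.
    by case: ifP => _ //; rewrite mcoeffZ mcoeffX mulr1n.
  have [uf|uf] := boolP (u \in msupp f).
    rewrite (bigD1_seq u) ?msupp_uniq //= eqxx mulr1 big1 ?addr0.
      by case: ifP.
    by move=> v /negPf ->; rewrite mulr0 mul0rn.
  rewrite (memN_msupp_eq0 uf) if_same big_seq big1 // => v vf.
  by case: eqP uf => [<-|_]; rewrite ?vf // mulr0 mul0rn.
(* The induction measure, finite without any appeal to well-foundedness of [le]. *)
pose below u := #|[set v : 'X_{1..n < k} | le v u]|%SET.
have main N f : J f ->
    (forall u, u \in msupp f -> (mdeg u < k)%N /\ (below u <= N)%N) -> I f.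
  elim: N f => [|N IHN] f Jf Hf.
    have [->|/initial_exists[m [mf _]]] := eqVneq f 0; first by case: Ii.
    have [mk] := Hf m mf.
    rewrite leqn0 cards_eq0 => /eqP/setP/(_ (BMultinom mk)).
    by rewrite !inE le_refl.
  have [->|/initial_exists[m fm]] := eqVneq f 0; first by case: Ii.
  have [g Ig gm] : initials I m by apply: inJI; exists f.
  have [mf mP] := fm; have [mg mPg] := gm.
  pose h := f - (f@_m / g@_m) *: g.
  have Ih : I h -> I f.
    move=> Ih; rewrite -[f](subrK ((f@_m / g@_m) *: g)); apply: ID => //.
    by rewrite -mul_mpolyC; apply: IZ.
  (* [le] need not refine the degree, so [g] may bring in monomials of degree at least [k];
     truncating again restores the bound. *)
  apply: Ih; have [h' Ihh' h'E] := trunc h.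
  rewrite -[h](subrK h'); apply: ID => //; apply: IHN.
    rewrite -[h'](subKr h); apply: idealB => //; last exact: IJ.
    by apply: idealB => //; rewrite -mul_mpolyC; apply/JZ/IJ.
  move=> u; rewrite mcoeff_msupp h'E; case: ifP; last by rewrite eqxx.
  move=> uk hu; split=> //.
  have um : le u m.
    have : u \in msupp h by rewrite mcoeff_msupp.
    by move=> /msuppB_le; rewrite mem_cat => /orP[/mP//|/msuppZ_le /mPg].
  have neum : u != m.
    apply: contraNneq hu => ->; rewrite /h mcoeffB mcoeffZ divfK ?subrr //.
    by rewrite -mcoeff_msupp.
  have [mk mN] := Hf m mf; rewrite -ltnS; apply: leq_trans mN.
  apply: proper_card; apply/properP; split.
    by apply/fintype.subsetP => v; rewrite !inE => /le_trans; apply.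
  exists (BMultinom mk); rewrite !inE /= ?le_refl //.
  by apply/negP => mu; case/eqP: neum; apply: le_anti.
move=> f Jf; have [g Ifg gE] := trunc f.
rewrite -[f](subrK g); apply: ID => //.
apply: (main #|{: 'X_{1..n < k}}|).
  by rewrite -[g](subKr f); apply: idealB => //; apply: IJ.
move=> u; rewrite mcoeff_msupp gE; case: ifP => [uk _|]; last by rewrite eqxx.
by split=> //; apply: max_card.
Qed.

(* Adjoining a monomial of maximal degree outside [J] enlarges [J] by a line. *)
Lemma exists_next_ideal k J : is_ideal J -> cofinite_at k J -> ~ J 1 ->
  exists J', [/\ is_ideal J', J `<` J'
    & (ncard (~` initials J) <= (ncard (~` initials J')).+1)%N].
Proof.
move=> Ji Jk J1; have [J0 JD JZ] := Ji.
pose bad d := `[< exists2 u, mdeg u = d & ~ J 'X_[u] >].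
have ex : exists d, bad d.
  by exists 0%N; apply/asboolP; exists 0%MM; rewrite ?mdeg0 // mpolyX0.
have bnd d : bad d -> (d <= k)%N.
  move=> /asboolP[u <- Ju]; apply: ltnW.
  by rewrite ltnNge; apply/negP => /Jk.
case: (ex_maxnP ex bnd) => d /asboolP[u ud Ju] dmax.
(* By maximality of [d], every proper multiple of [X^u] lies in [J]. *)
have Jv v : (0 < mdeg v)%N -> J 'X_[v + u].
  move=> v0; apply: contrapT => Jvu.
  have /dmax : bad (mdeg v + d)%N.
    by apply/asboolP; exists (v + u)%MM => //; rewrite mdegD ud.
  by rewrite -{2}[d]add0n leq_add2r leqNgt v0.
pose J' := [set f : P | exists c : K, J (f - c *: 'X_[u])].
have J'i : is_ideal J'.
  split=> [|f g [c Jf] [c' Jg]|h f [c Jf]].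
  - by exists 0; rewrite scale0r subr0.
  - by exists (c + c'); rewrite scalerDl opprD addrACA; apply: JD.
  (* Modulo [J], multiplying [X^u] by [h] only sees the constant term of [h]. *)
  - pose h0 := mcoeff 0%MM h; exists (h0 * c).
    have -> : h * f - (h0 * c) *: 'X_[u] =
        h * (f - c *: 'X_[u]) + c%:MP * ((h - h0%:MP) * 'X_[u]).
      rewrite mulrBr mulrBl -!mul_mpolyC mpolyCM; ring.
    apply: JD; first exact: JZ.
    apply: JZ; apply: ideal_sum => // w.
    move=> /msuppM_le /allpairsP[[a b] /= [ha]].
    rewrite msuppX inE => /eqP -> ->; apply: Jv.
    rewrite lt0n mdeg_eq0; apply: contraTneq ha => ->.
    by rewrite mcoeff_msupp mcoeffB mcoeffC eqxx mulr1 subrr eqxx.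
have JJ' : J `<=` J' by move=> f Jf; exists 0; rewrite scale0r subr0.
exists J'; split=> //.
  split=> // /(_ 'X_[u]) J'u; apply/Ju/J'u.
  by exists 1; rewrite scale1r subrr.
have J'k : cofinite_at k J' by move=> v /Jk /JJ'.
(* At most one initial monomial is new: if [f] and [g] had new ones [v < w], a combination
   cancelling [X^u] would lie in [J] and still have initial monomial [w]. *)
have uniq_new v w : initials J' v -> ~ initials J v ->
    initials J' w -> ~ initials J w -> le v w -> v = w.
  move=> [f [c Jf] fv] Jv' [g [c' Jg] [wg wP]] Jw vw.
  apply: contrapT => nvw; apply: Jw.
  have c0 : c != 0.
    apply/eqP => c0; apply: Jv'; exists f => //.
    by move: Jf; rewrite c0 scale0r subr0.
  exists (g - (c' / c) *: f).
    have -> : g - (c' / c) *: f =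
        (g - c' *: 'X_[u]) - (c' / c)%:MP * (f - c *: 'X_[u]).
      by rewrite mul_mpolyC scalerBr scalerA divfK // opprB addrA subrK.
    by apply: idealB => //; apply: JZ.
  have [vf vP] := fv; split.
    rewrite mcoeff_msupp mcoeffB mcoeffZ (memN_msupp_eq0 (m:=w) (p:=f)).
      by rewrite mulr0 subr0 -mcoeff_msupp.
    by apply/negP => /vP wv; apply: nvw; apply: le_anti.
  move=> x /msuppB_le; rewrite mem_cat => /orP[/wP//|/msuppZ_le /vP xv].
  exact: le_trans vw.
have [[w J'w Jw]|none] := pselect (exists2 w, initials J' w & ~ initials J w).
  apply: leq_trans (ncardU1 w (finite_standard J'k)).
  apply: ncard_sub.
    rewrite finite_setU; split; first exact: finite_set1.
    exact: finite_standard J'k.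
  move=> v Jv'; have [J'v|] := pselect (initials J' v); last by right.
  left; have [tot _ _ _ _] := le_order.
  by have /orP[vw|wv] := tot v w; [|symmetry]; apply: uniq_new.
apply/leqW/ncard_sub; first exact: finite_standard J'k.
by move=> v Jv' J'v; apply: none; exists v.
Qed.

(** Iterates [exists_next_ideal]: each step loses at most one standard monomial, so [N] of them
    allow [N] steps. *)
Lemma exists_ideal_chain k J N : is_ideal J -> cofinite_at k J ->
  (N <= ncard (~` initials J))%N -> exists c, quotient_chain J N c.
Proof.
elim: N J => [|N IHN] J Ji Jk NJ.
  by exists (fun=> J); split.
(* The unit ideal has no standard monomial. *)
have J1 : ~ J 1.
  move=> J1; move: NJ; suff -> : ~` initials J = set0.
    by rewrite /ncard fset_set0.
  rewrite -subset0 => u; apply; exists 'X_[u]; last exact: initialX.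
  by rewrite -[X in J X]mul1r; apply: idealMr.
have [J' [J'i [JJ' nJJ'] NJ']] := exists_next_ideal Ji Jk J1.
have [||c [ci c0 cs]] := IHN J' J'i; first by move=> u /Jk /JJ'.
  exact: leq_trans NJ NJ'.
exists (fun i => if i is j.+1 then c j else J); split=> // -[|i] //=.
- exact: ci.
- move=> _; split; first exact: subset_trans c0.
  by move=> c0J; apply: nJJ'; apply: subset_trans c0J.
- exact: cs.
Qed.

End InitialMonomials.

(** * Localization at the origin *)

Section Localization.
Variables (K : fieldType) (n : nat).
Local Notation P := {mpoly K[n]}.
Local Notation A := (local_ring K n).
Local Notation "x %:F" := (FracField.tofrac (x : P)).
Implicit Types (J : set P) (f g : P).

Let nz g : g.@[fun=> 0] != 0 -> g%:F != 0.
Proof.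
by move=> g0; rewrite tofrac_eq0; apply: contraNneq g0 => ->; rewrite meval0.
Qed.

Lemma exists_fraction f g :
  g.@[fun=> 0] != 0 -> exists x : A, \val x = f%:F / g%:F.
Proof.
move=> g0; have xr : f%:F / g%:F \in @regular_at_origin K n.
  by apply/asboolP; exists f, g.
by exists (LocalRing xr).
Qed.

Lemma fractionP (x : A) : exists f g, g.@[fun=> 0] != 0 /\ \val x = f%:F / g%:F.
Proof. by case: x => x /= /asboolP. Qed.

Lemma valD (x y : A) : \val (x + y) = \val x + \val y. Proof. by []. Qed.
Lemma valM (x y : A) : \val (x * y) = \val x * \val y. Proof. by []. Qed.

(** The default [0] of [insubd] is never taken, as [f / 1] is regular at the origin. *)
Definition in_localization f : A := insubd 0 f%:F.

Lemma val_in_localization f : \val (in_localization f) = f%:F.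
Proof.
rewrite val_insubd; case: ifP => // /asboolP[]; exists f, 1.
by rewrite meval1 oner_neq0 tofrac1 divr1.
Qed.

Lemma in_localizationD f g :
  in_localization (f + g) = in_localization f + in_localization g.
Proof. by apply: val_inj; rewrite valD !val_in_localization tofracD. Qed.

Lemma in_localizationM f g :
  in_localization (f * g) = in_localization f * in_localization g.
Proof. by apply: val_inj; rewrite valM !val_in_localization tofracM. Qed.

Lemma in_localization0 : in_localization 0 = 0.
Proof. by apply: val_inj; rewrite val_in_localization tofrac0. Qed.

Definition contraction (c : set A) : set P := [set f | c (in_localization f)].

Lemma contraction_ideal (c : set A) : is_ideal c -> is_ideal (contraction c).
Proof.
case=> c0 cD cZ; split=> [|f g|h f]; rewrite /contraction /=.
- by rewrite in_localization0.
- by rewrite in_localizationD; apply: cD.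
- by rewrite in_localizationM; apply: cZ.
Qed.

Lemma sub_contraction J : J `<=` contraction (localize J).
Proof.
move=> f Jf; apply: sub_gen_smallest; exists f => //.
exact: val_in_localization.
Qed.

(** By common denominators, the fractions with numerator in [J] already form an ideal. *)
Lemma localizeP J (x : A) : is_ideal J -> localize J x <->
  exists f g, [/\ J f, g.@[fun=> 0] != 0 & \val x = f%:F / g%:F].
Proof.
move=> [J0 JD JZ]; split; last first.
  move=> [f [g [Jf g0 xE]]].
  have [y yE] := exists_fraction 1 g0.
  have -> : x = y * in_localization f.
    apply: val_inj; rewrite valM val_in_localization yE xE tofrac1.
    by rewrite mul1r mulrC.
  have [_ _ LZ] : is_ideal (localize J) := ideal_gen_ideal _.
  by apply: LZ; apply: sub_contraction.
suff : localize J `<=` [set x : A |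
    exists f g, [/\ J f, g.@[fun=> 0] != 0 & \val x = f%:F / g%:F]] by apply.
apply: smallest_sub.
  split=> [|{}x y [f [g [Jf g0 xE]]] [f' [g' [Jf' g'0 yE]]]|
           y {}x [f [g [Jf g0 xE]]]].
  - by exists 0, 1; rewrite meval1 oner_neq0 tofrac0 mul0r.
  - exists (g' * f + g * f'), (g * g'); split.
    + by apply: JD; apply: JZ.
    + by rewrite mevalM mulf_neq0.
    + rewrite valD xE yE addf_div ?nz // tofracD !tofracM.
      by rewrite ![g%:F * _]mulrC [g'%:F * _]mulrC.
  - have [f' [g' [g'0 yE]]] := fractionP y.
    exists (f' * f), (g' * g); split; first exact: JZ.
      by rewrite mevalM mulf_neq0.
    by rewrite valM xE yE mulf_div !tofracM.
move=> {}x [f Jf xE]; exists f, 1.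
by rewrite meval1 oner_neq0 tofrac1 divr1.
Qed.

Lemma localize_mul I J L : is_ideal I -> is_ideal J -> is_ideal L ->
  ideal_mul I J `<=` L -> ideal_mul (localize I) (localize J) `<=` localize L.
Proof.
move=> Ii Ji Li IJL; apply: ideal_mul_sub; first exact: ideal_gen_ideal.
move=> x y /(localizeP _ Ii)[f [g [If g0 xE]]].
move=> /(localizeP _ Ji)[f' [g' [Jf g'0 yE]]].
apply/localizeP => //; exists (f * f'), (g * g'); split.
- by apply: IJL; apply: mem_ideal_mul.
- by rewrite mevalM mulf_neq0.
- by rewrite valM xE yE mulf_div !tofracM.
Qed.

(** Lets the powers in the definition of the multiplicity be taken before localizing. *)
Lemma localize_exp J t : is_ideal J ->
  localize (ideal_exp J t) = ideal_exp (localize J) t.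
Proof.
move=> Ji; have Ei s := ideal_exp_ideal J s.
have Li s : is_ideal (ideal_exp (localize J) s) := ideal_exp_ideal _ s.
apply/seteqP; split.
  (* It suffices to treat the generators, which are polynomials, so the right side is pulled back to
     polynomials. *)
  have sub : ideal_exp J t `<=` contraction (ideal_exp (localize J) t).
    elim: t => [//|t IHt]; apply: ideal_mul_sub; first exact: contraction_ideal.
    move=> f g Jf Jg; rewrite /contraction /= in_localizationM.
    by apply: mem_ideal_mul; [exact: sub_contraction|exact: IHt].
  apply: smallest_sub => // x [f /sub cf xE].
  suff -> : x = in_localization f by [].
  by apply: val_inj; rewrite val_in_localization.
elim: t => [|t IHt] x Ix.
  by apply/localizeP => //; have [f [g [g0 xE]]] := fractionP x; exists f, g.
apply: (@localize_mul J (ideal_exp J t) (ideal_exp J t.+1)) => //.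
move: x Ix; apply: ideal_mul_sub; first exact: ideal_mul_ideal.
by move=> x y Jx /IHt Jy; apply: mem_ideal_mul.
Qed.

Lemma meval_origin f : f.@[fun=> 0] = mcoeff 0%MM f.
Proof.
rewrite [f in RHS]mpolyE raddf_sum mevalE; apply: eq_bigr => m _ /=.
rewrite mcoeffZ mcoeffX; congr (_ * _).
have [->|m0] := eqVneq m 0%MM; first by rewrite big1 // => i _; rewrite mnm0E.
have [i mi] := mnm_neq0 m0.
by rewrite (bigD1 i) //= expr0n (negPf mi) mul0r.
Qed.

(* Modulo [J] a polynomial not vanishing at the origin is a nonzero constant
   plus a nilpotent, hence invertible. *)
Lemma cofinite_saturated k J f g : is_ideal J -> cofinite_at k J ->
  g.@[fun=> 0] != 0 -> J (g * f) -> J f.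
Proof.
move=> Ji Jk g0 Jgf; have [_ _ JZ] := Ji.
set c := g.@[fun=> 0] in g0; pose p := c%:MP - g.
have p0 : mcoeff 0%MM p = 0.
  by rewrite /p mcoeffB mcoeffC eqxx mulr1 /c meval_origin subrr.
(* [p] has no constant term, so [p ^+ j] vanishes to order at least [j]. *)
have pX j u : u \in msupp (p ^+ j) -> (j <= mdeg u)%N.
  elim: j u => [//|j IHj] u; rewrite exprS.
  move=> /msuppM_le /allpairsP[[a b] /= [pa /IHj jb ->]].
  rewrite mdegD -add1n leq_add // lt0n mdeg_eq0; apply: contraTneq pa => ->.
  by rewrite mcoeff_msupp p0 eqxx.
have Jp : J (p ^+ k) by apply: ideal_sum => // u /pX; apply: Jk.
(* [c ^ k - p ^ k] is a multiple of [c - p = g]; afterwards the nonzero constant [c ^ k] is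
   cancelled. *)
have : J (c%:MP ^+ k * f).
  have -> : c%:MP ^+ k * f = (c%:MP ^+ k - p ^+ k) * f + f * p ^+ k by ring.
  have [_ JD _] := Ji; apply: JD; last exact: JZ.
  by rewrite subrXX subKr mulrC mulrA mulrC; apply: JZ; rewrite mulrC.
rewrite -rmorphXn => /(JZ ((c ^- k)%:MP)).
by rewrite mulrA -mpolyCM mulVf ?mpolyC1 ?mul1r // expf_neq0.
Qed.

(** If [f = f' / g] with [f'] in [J], then [g f] lies in [J], and [cofinite_saturated] cancels
    [g]. *)
Lemma contraction_localize k J : is_ideal J -> cofinite_at k J ->
  contraction (localize J) = J.
Proof.
move=> Ji Jk; apply/seteqP; split; last exact: sub_contraction.
move=> f /(localizeP _ Ji)[f' [g [Jf' g0]]].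
rewrite val_in_localization => /(congr1 (fun x => x * g%:F)).
rewrite divfK ?nz // -tofracM => /eqP; rewrite tofrac_eq => /eqP fE.
by apply: (cofinite_saturated Ji Jk g0); rewrite mulrC fE.
Qed.

(** An element [f / g] of the local ring is a unit multiple of [f], so an ideal is determined by the
    polynomials in it. *)
Lemma contraction_inj (c d : set A) : is_ideal c -> is_ideal d ->
  contraction c `<=` contraction d -> c `<=` d.
Proof.
move=> [_ _ cZ] [_ _ dZ] cd x cx; have [f [g [g0 xE]]] := fractionP x.
have : d (in_localization f).
  apply: cd; rewrite /contraction /=.
  suff -> : in_localization f = in_localization g * x by apply: cZ.
  by apply: val_inj; rewrite valM !val_in_localization xE mulrC divfK ?nz.
have [y yE] := exists_fraction 1 g0.
move=> /(dZ y); suff -> : y * in_localization f = x by [].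
by apply: val_inj; rewrite valM val_in_localization xE yE tofrac1 mul1r mulrC.
Qed.

(** * Length of the localized quotient *)

Section Length.
Variable le : rel 'X_{1..n}.
Hypothesis le_order : monomial_order le.

Definition colength J : nat := ncard (~` initials le J).

(** Contraction keeps the chain strict, and by [initials_inj] so does passage to initial monomials;
    each step then uses up at least one standard monomial. *)
Lemma quotient_chain_leq k J N c : is_ideal J -> cofinite_at k J ->
  quotient_chain (localize J) N c -> (N <= colength J)%N.
Proof.
move=> Ji Jk [ci c0 cs].
have Ci i : (i <= N)%N -> is_ideal (contraction (c i)).
  by move=> /ci; apply: contraction_ideal.
have Cs i : (i < N)%N -> contraction (c i) `<=` contraction (c i.+1).
  by move=> /cs[cc _] f; apply: cc.
have JC i : (i <= N)%N -> J `<=` contraction (c i).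
  elim: i => [_|i IHi iN]; first by move=> f /sub_contraction /c0.
  exact: subset_trans (IHi (ltnW iN)) (Cs _ iN).
have Jk' : cofinite_at k (contraction (c 0%N)) by move=> u /Jk; apply: JC.
apply: (@leq_trans (ncard (~` initials le (contraction (c 0%N))))); last first.
  apply: ncard_sub; first exact: finite_standard Jk.
  exact/subsetC/initials_sub/JC.
apply: (@chain_ncard _ (fun i => initials le (contraction (c i)))).
  exact: finite_standard Jk'.
move=> i iN; split; first exact/initials_sub/Cs.
move=> inC; have [_ ] := cs i iN; apply.
apply: contraction_inj; [exact: ci|exact/ci/ltnW|].
apply: (initials_inj le_order (k := k)) inC;
  [exact/Ci/ltnW|exact: Ci| |exact: Cs].
by move=> u /Jk; apply/JC/ltnW.
Qed.

(** Strictness survives localization because contraction recovers each ideal of the chain. *)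
Lemma exists_quotient_chain k J : is_ideal J -> cofinite_at k J ->
  exists c, quotient_chain (localize J) (colength J) c.
Proof.
move=> Ji Jk.
have [c [ci c0 cs]] := exists_ideal_chain le_order Ji Jk (leqnn _).
have Jc i : (i <= colength J)%N -> J `<=` c i.
  elim: i => [//|i IHi iN]; apply: subset_trans (IHi (ltnW iN)) _.
  by have [] := cs i iN.
have Jck i : (i <= colength J)%N -> cofinite_at k (c i).
  by move=> iN u /Jk; apply: Jc.
have locS (I L : set P) : I `<=` L -> localize I `<=` localize L.
  move=> IL; apply: sub_smallest2r; first exact: ideal_gen_ideal.
  by move=> x [f /IL Lf xE]; exists f.
exists (fun i => localize (c i)); split.
- by move=> i _; apply: ideal_gen_ideal.
- exact: locS.
- move=> i iN; have [cc ncc] := cs i iN; split; first exact: locS.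
  move=> lcc; apply: ncc.
  rewrite -(contraction_localize (ci _ (ltnW iN)) (Jck _ (ltnW iN))).
  by rewrite -(contraction_localize (ci _ iN) (Jck _ iN)) => f; apply: lcc.
Qed.

End Length.
End Localization.

(** * Counting complements in a graded family of monomial sets, such as the initial monomials of
    [a p] *)

Section GradedMonomials.
Variables (n : nat) (b : nat -> set 'X_{1..n}).
Hypothesis n_gt0 : (0 < n)%N.
Hypothesis b_up : forall p u v, b p u -> b p (u + v)%MM.
Hypothesis b_add : forall p q u v, b p u -> b q v -> b (p + q) (u + v)%MM.
Hypothesis b_cofinite : forall p, exists k, forall u, (k <= mdeg u)%N -> b p u.

Let b_le p u v : (u <= v)%MM -> b p u -> b p v.
Proof. by move=> /submK <- bu; rewrite addmC; apply: b_up. Qed.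

Let b_muln p u t : (0 < t)%N -> b p u -> b (p * t) (u *+ t)%MM.
Proof.
case: t => // t _ bu; elim: t => [|t IHt]; first by rewrite muln1.
by rewrite mulnS mulmS; apply: b_add.
Qed.

Let finite_b p : finite_set (~` b p).
Proof.
have [k bk] := b_cofinite p.
apply: sub_finite_set (@finite_mdeg_lt n k) => u /= bu.
by rewrite ltnNge; apply/negP => /bk.
Qed.

(** One bound serves all remainders modulo [m]. *)
Lemma finite_cofinite_uniform m :
  exists k, forall r u, (r < m)%N -> (k <= mdeg u)%N -> b r u.
Proof.
elim: m => [|m [k bk]]; first by exists 0%N.
have [l bl] := b_cofinite m; exists (maxn k l) => r u.
rewrite ltnS leq_eqVlt geq_max => /orP[/eqP-> /andP[_ /bl]//|rm /andP[ku _]].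
exact: bk.
Qed.

(* Write [N = m t + r] with [r < m]. A monomial [u] outside [b N] either has a
   bounded exponent at [i0], or is [t v] plus a remainder in the box [0, t)^n
   plus a fixed monomial lying in [b r], where [v] is outside [b m]. *)
Lemma graded_ncard_le m : (0 < m)%N -> exists C, forall N, (0 < N)%N ->
  (m ^ n * ncard (~` b N) <= N ^ n * ncard (~` b m) + C * N ^ n.-1)%N.
Proof.
move=> m0; have [k bk] := b_cofinite 1.
have [K bK] := finite_cofinite_uniform m.
pose i0 : 'I_n := Ordinal n_gt0.
(* The power [X_i ^ k] lies in [b 1], so outside [b N] every exponent is below [k N]. *)
have bN N (u : 'X_{1..n}) i : (0 < N)%N -> (k * N <= u i)%N -> b N u.
  move=> N0 ku; apply: (@b_le _ ((U_(i) *+ k) *+ N)%MM).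
    apply/mnm_lepP => j; rewrite !mulmnE mnm1E.
    by case: eqP => [<-|_]; rewrite ?mul1n // !mul0n.
  rewrite -[N in b N]mul1n; apply: b_muln => //; apply: bk.
  by rewrite mdegMn mdeg1 mul1n.
(* [K (k N) ^ (n - 1)] will bound [B2]; [m ^ n] is the factor on the left side. *)
exists (m ^ n * (K * k ^ n.-1))%N => N N0.
pose t := (N %/ m)%N; pose r := (N %% m)%N.
have rm : (r < m)%N by rewrite ltn_mod.
have NE : N = (m * t + r)%N by rewrite mulnC -divn_eq.
pose w := (U_(i0) *+ K)%MM : 'X_{1..n}.
have bw (u : 'X_{1..n}) : b r (u + w)%MM.
  by rewrite addmC; apply/b_up/bK => //; rewrite mdegMn mdeg1 mul1n.
pose B1 := ~` b N `&` [set u | (K <= u i0)%N].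
pose B2 := ~` b N `&` [set u | (u i0 < K)%N].
have fB1 : finite_set B1 by apply: sub_finite_set (finite_b N) => u [].
have fB2 : finite_set B2 by apply: sub_finite_set (finite_b N) => u [].
have c1 : (ncard B1 <= ncard (~` b m) * t ^ n)%N.
  (* The exponents of [u - w] are divided by [t]: the quotients form [v], outside [b m], and the
     remainders lie in ['I_t]. *)
  pose phi (x : fset_set (~` b m) * {ffun 'I_n -> 'I_t}) : 'X_{1..n} :=
    (val x.1 *+ t + [multinom (x.2 i : nat) | i < n] + w)%MM.
  have : B1 `<=` range phi.
    move=> u [bu /= Ku].
    have wu : (w <= u)%MM.
      apply/mnm_lepP => j; rewrite mulmnE mnm1E.
      by case: eqP => [<-|_]; rewrite ?mul1n.
    (* If [t = 0] then [N = r], and [u], a multiple of [w], would lie in [b N]. *)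
    have t0 : (0 < t)%N.
      rewrite lt0n; apply/eqP => t0; apply: bu.
      by rewrite NE t0 muln0 add0n -(submK wu).
    pose v := [multinom ((u - w)%MM i %/ t)%N | i < n].
    have vu : (v *+ t <= u - w)%MM.
      by apply/mnm_lepP => j; rewrite mulmnE mnmE leq_trunc_div.
    have bv : v \in fset_set (~` b m).
      rewrite in_fset_set // inE => bv; apply: bu.
      rewrite -(submK wu) NE; apply: b_add; last by rewrite -[w]add0m.
      by apply: b_le vu _; apply: b_muln.
    exists ([` bv]%fset,
            [ffun i => Ordinal (ltn_pmod ((u - w)%MM i) t0)]) => //.
    rewrite /phi /= -[RHS](submK wu); congr (_ + _)%MM; apply/mnmP => i.
    rewrite mnmDE mulmnE [v i]mnmE.
    by rewrite [[multinom _ | _ < _] i]mnmE ffunE /= -divn_eq.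
  move=> /ncard_range; rewrite card_prod card_ffun !card_ord -cardfE.
  by [].
have c2 : (ncard B2 <= K * (k * N) ^ n.-1)%N.
  (* The exponent at [i0] is below [K], and the other [n - 1] exponents are below [k N]. *)
  pose phi (x : 'I_K * {ffun 'I_n.-1 -> 'I_(k * N)}) : 'X_{1..n} :=
    [multinom (if unlift i0 i is Some j then x.2 j : nat else x.1) | i < n].
  have : B2 `<=` range phi.
    move=> u [bu /= uK].
    have uN i : (u i < k * N)%N by rewrite ltnNge; apply/negP => /(bN _ _ _ N0).
    exists (Ordinal uK, [ffun j => Ordinal (uN (lift i0 j))]) => //.
    apply/mnmP => i; rewrite mnmE; case: unliftP => [j ->|->] //=.
    by rewrite ffunE.
  by move=> /ncard_range; rewrite card_prod card_ffun !card_ord.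
have : (ncard (~` b N) <= ncard B1 + ncard B2)%N.
  apply: leq_trans (ncardU fB1 fB2); apply: ncard_sub.
    by rewrite finite_setU.
  by move=> u bu; have [?|?] := leqP K (u i0); [left|right].
move=> /leq_trans /(_ (leq_add c1 c2)) /(leq_mul (leqnn (m ^ n))) /leq_trans.
apply; rewrite mulnDr leq_add //.
  (* The main term carries [(m t) ^ n], which is at most [N ^ n]. *)
  rewrite mulnCA mulnC -expnMn leq_mul2r leq_exp2r // [X in (_ <= X)%N]NE.
  by rewrite leq_addr orbT.
by rewrite expnMn !mulnA.
Qed.

End GradedMonomials.
End Polynomials.

From mathcomp Require Import reals constructive_ereal ereal topology.
From mathcomp Require Import normedtype sequences.
From mathcomp Require Import -(notations) mpoly.
Import numFieldNormedType.Exports.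

(** * Limits of normalized counts *)

Section Limits.
Variable R : realType.

Lemma cvg_scale (c : R) (u : nat -> R) (L : R) :
  u @ \oo --> L -> (fun t => c * u t) @ \oo --> c * L.
Proof. by move=> uL; apply: cvgM => //; apply: cvg_cst. Qed.

(** A variant of Fekete's lemma: choose [m] with [v m] within [e / 2] of the infimum over positive
    indices, then [N] so large that [C / N < e / 2]. *)
Lemma cvg_inf_of_bound (v : nat -> R) : (forall m, 0 <= v m) ->
  (forall m, (0 < m)%N -> exists C : R, forall N, (0 < N)%N ->
     v N <= v m + C / N%:R) ->
  exists L : R, v @ \oo --> L /\ forall m, (0 < m)%N -> L <= v m.
Proof.
move=> v0 vb; pose S := [set v m | m in [set m | (0 < m)%N]].
have lbS : has_inf S.
  split; first by exists (v 1%N), 1%N.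
  by exists 0 => _ [m _ <-].
have Lv m : (0 < m)%N -> inf S <= v m.
  by move=> m0; apply: ge_inf; [case: lbS|exists m].
exists (inf S); split=> //; apply/cvgrPdist_lt => e e0.
have [_ [m m0 <-] vm] := inf_adherent (divr_gt0 e0 (ltr0n R 2)) lbS.
have [C vC] := vb m m0.
near=> N.
have N0 : (0 < N)%N by near: N; exists 1%N.
rewrite distrC ger0_norm ?subr_ge0 ?Lv // ltrBlDl.
apply: le_lt_trans (vC N N0) _.
have NC : `|C| / (e / 2) < N%:R by near: N; apply: nbhs_infty_gtr.
have : C / N%:R < e / 2.
  rewrite ltr_pdivrMr ?ltr0n //; apply: le_lt_trans (ler_norm C) _.
  by rewrite mulrC -ltr_pdivrMr // divr_gt0.
move=> /(ltrD vm) /lt_le_trans; apply.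
by rewrite -addrA -splitr.
Unshelve. all: by end_near.
Qed.

Section Monomials.
Variables (n : nat) (b : nat -> set (multinom n)).
Hypothesis n_gt0 : (0 < n)%N.
Hypothesis b_up : forall p u v, b p u -> b p (mnm_add u v).
Hypothesis b_add : forall p q u v, b p u -> b q v -> b (p + q)%N (mnm_add u v).
Hypothesis b_cofinite : forall p, exists k, forall u, (k <= mdeg u)%N -> b p u.

(** Dividing [graded_ncard_le] by [m ^ n N ^ n] gives the bound that [cvg_inf_of_bound] asks for. *)
Lemma graded_density :
  exists L : R, (fun m => (ncard (~` b m))%:R / m%:R ^+ n) @ \oo --> L /\
    forall m, (0 < m)%N -> L <= (ncard (~` b m))%:R / m%:R ^+ n.
Proof.
apply: cvg_inf_of_bound => [m|m m0]; first by rewrite divr_ge0 ?exprn_ge0.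
have [C bC] := graded_ncard_le n_gt0 b_up b_add b_cofinite m0.
exists (C%:R / m%:R ^+ n) => N N0.
have mn0 : (0 : R) < m%:R ^+ n by rewrite exprn_gt0 ?ltr0n.
have Nn0 : (0 : R) < N%:R ^+ n by rewrite exprn_gt0 ?ltr0n.
have : (m%:R ^+ n * (ncard (~` b N))%:R <=
  N%:R ^+ n * (ncard (~` b m))%:R + C%:R * N%:R ^+ n.-1 :> R).
  by rewrite -!natrX -!natrM -natrD ler_nat; apply: bC.
rewrite -subr_ge0 => H; rewrite -subr_ge0.
have -> : (ncard (~` b m))%:R / m%:R ^+ n + C%:R / m%:R ^+ n / N%:R -
    (ncard (~` b N))%:R / N%:R ^+ n =
  (N%:R ^+ n * (ncard (~` b m))%:R + C%:R * N%:R ^+ n.-1 -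
   m%:R ^+ n * (ncard (~` b N))%:R) / (m%:R ^+ n * N%:R ^+ n) :> R.
  have E (x : R) : x ^+ n = x * x ^+ n.-1 by rewrite -exprS prednK.
  rewrite !E; field.
  by rewrite !pnatr_eq0 -!lt0n m0 N0 !expf_neq0 // pnatr_eq0 -lt0n.
by rewrite divr_ge0 // mulr_ge0 // ltW.
Qed.

End Monomials.
End Limits.

(** * Multiplicities and colengths *)

Section Multiplicity.
Variables (R : realType) (K : fieldType) (n : nat) (le : rel (multinom n)).
Hypothesis n_gt0 : (0 < n)%N.
Hypothesis le_order : monomial_order le.
Local Notation P := (mpoly n K).
Implicit Types (I J : set P) (a : nat -> set P).

Lemma quotient_length_localize k J : is_ideal J -> cofinite_at k J ->
  quotient_length R (localize J) = (colength le J)%:R%:E.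
Proof.
move=> Ji Jk; apply/eqP; rewrite eq_le; apply/andP; split.
  apply: ge_ereal_sup => _ [N [c cN] <-]; rewrite lee_fin ler_nat.
  exact: (quotient_chain_leq le_order Ji Jk cN).
apply: ereal_sup_ubound; exists (colength le J) => //.
exact: (exists_quotient_chain le_order Ji Jk).
Qed.

Definition cofinite a := forall m, exists k, cofinite_at k (a m).

Lemma colength_cvg a : graded_sequence a -> cofinite a ->
  exists L : R, (fun m => (colength le (a m))%:R / m%:R ^+ n) @ \oo --> L /\
    forall m, (0 < m)%N -> L <= (colength le (a m))%:R / m%:R ^+ n.
Proof.
move=> [ai aM] ac; apply: graded_density => //.
- by move=> p u v; apply: initials_up.
- by move=> p q u v; apply: initials_mul.
- by move=> p; have [k ak] := ac p; exists k => u; apply: initials_cofinite.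
Qed.

Lemma cofinite_ideal_exp k J : cofinite_at k J -> cofinite (ideal_exp J).
Proof. by move=> Jk t; exists (k * t)%N; apply: cofinite_exp. Qed.

(** [mult] is a [limn], meaningful only once convergence is known; the powers of [J] form a graded
    sequence, to which [colength_cvg] applies. *)
Lemma mult_cvg k J : is_ideal J -> cofinite_at k J ->
  (fun t => n`!%:R * ((colength le (ideal_exp J t))%:R / t%:R ^+ n)) @ \oo
    --> mult R J.
Proof.
move=> Ji Jk.
have [L [cL _]] := colength_cvg (graded_ideal_exp J) (cofinite_ideal_exp Jk).
have cvgL := cvg_scale (c := n`!%:R) cL.
suff -> : mult R J = n`!%:R * L by [].
apply: cvg_lim => //; apply: cvg_trans cvgL; apply: near_eq_cvg; near=> t.
rewrite -localize_exp // (@quotient_length_localize (k * t)) ?mulrA //.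
  exact: ideal_exp_ideal.
exact: cofinite_exp.
Unshelve. all: by end_near.
Qed.

(* Lech's inequality. *)
Lemma mult_le_colength k J : is_ideal J -> cofinite_at k J ->
  mult R J <= n`!%:R * (colength le J)%:R.
Proof.
move=> Ji Jk.
have [L [cL LJ]] := colength_cvg (graded_ideal_exp J) (cofinite_ideal_exp Jk).
rewrite -(cvg_lim _ (mult_cvg Ji Jk)) //.
rewrite (cvg_lim _ (cvg_scale (c := n`!%:R) cL)) //.
apply: ler_wpM2l => //.
(* The limit [L] is a lower bound of all terms, in particular of the one at [t = 1]. *)
by have := LJ 1%N isT; rewrite ideal_exp1 // expr1n divr1.
Qed.

(** The sequence is squeezed between [n! L] and [n!] times the normalized colengths. *)
Lemma mult_seq_cvg a (L : R) : graded_sequence a -> cofinite a ->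
  (fun m => (colength le (a m))%:R / m%:R ^+ n) @ \oo --> L ->
  mult_seq R a @ \oo --> n`!%:R * L.
Proof.
move=> ga ac cL; have [ai aM] := ga.
have [L' [cL' L'a]] := colength_cvg ga ac.
have La m : (0 < m)%N -> L <= (colength le (a m))%:R / m%:R ^+ n.
  by move=> m0; rewrite (cvg_unique _ cL cL') //; apply: L'a.
have cU := cvg_scale (c := n`!%:R) cL.
apply: (squeeze_cvgr _ (cvg_cst (n`!%:R * L)) cU); near=> m.
have m0 : (0 < m)%N by near: m; exists 1%N.
have mn0 : (0 : R) < m%:R ^+ n by rewrite exprn_gt0 ?ltr0n.
have [k ak] := ac m; rewrite /mult_seq; apply/andP; split; last first.
  by rewrite mulrA ler_pM2r ?invr_gt0 //; apply: mult_le_colength ak.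
(* Lower bound: [(a m) ^ t] is contained in [a (m t)], whose colength is at least [L (m t) ^ n];
   then [t] tends to infinity. *)
rewrite ler_pdivlMr // -(cvg_lim _ (mult_cvg (ai m) ak)) //.
apply: limr_ge.
  by apply/cvg_ex; exists (mult R (a m)); apply: mult_cvg ak.
near=> t; have t0 : (0 < t)%N by near: t; exists 1%N.
have tn0 : (0 : R) < t%:R ^+ n by rewrite exprn_gt0 ?ltr0n.
rewrite -mulrA ler_wpM2l // ler_pdivlMr // -mulrA -exprMn -natrM.
have mt0 : (0 < m * t)%N by rewrite muln_gt0 m0.
have := La _ mt0; rewrite ler_pdivlMr ?exprn_gt0 ?ltr0n // => /le_trans; apply.

rewrite ler_nat; apply: ncard_sub.
  exact: (finite_standard le_order (cofinite_exp ak)).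
apply/subsetC/initials_sub.
exact: graded_exp_sub.
Unshelve. all: by end_near.
Qed.

Lemma graded_initial_ideal a : graded_sequence a ->
  graded_sequence (fun m => initial_ideal le (a m)).
Proof.
move=> [ai aM]; split=> [m|p q]; first exact: ideal_gen_ideal.
exact: initial_ideal_mul.
Qed.

(** Passing to initial ideals leaves every colength unchanged, so the same [L] serves both
    sequences. *)
Lemma mult_seq_initial_cvg a (L : R) : graded_sequence a -> cofinite a ->
  (fun m => (colength le (a m))%:R / m%:R ^+ n) @ \oo --> L ->
  mult_seq R (fun m => initial_ideal le (a m)) @ \oo --> n`!%:R * L.
Proof.
move=> ga ac cL; have [ai _] := ga.
apply: mult_seq_cvg; first exact: graded_initial_ideal.
  by move=> m; have [k ak] := ac m; exists k; apply: cofinite_initial_ideal.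
suff -> : (fun m => (colength le (initial_ideal le (a m)))%:R / m%:R ^+ n : R) =
  (fun m => (colength le (a m))%:R / m%:R ^+ n) by [].
by apply/funext => m; rewrite /colength initials_initial_ideal.
Qed.

End Multiplicity.

Theorem corollary1p13 (R : realType) (K : fieldType) (n : nat)
    (le : rel (multinom n)) (n_ge1 : (1 <= n)%N)
    (le_order : monomial_order le) :
  (forall a : nat -> set (mpoly n K),
     graded_sequence a ->
     (forall m, supported_at_origin (a m)) ->
     let a' := fun m => initial_ideal le (a m) in
     [/\ cvgn (mult_seq R a), cvgn (mult_seq R a')
       & asymptotic_mult R a = asymptotic_mult R a'])
  /\
  (forall I : set (mpoly n K),
     is_ideal I -> supported_at_origin I ->
     (fun m : nat => mult R (initial_ideal le (ideal_exp I m)) / m%:R ^+ n)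
       @ \oo --> mult R I).
Proof.
split=> [a ga sa a'|I Ii /supported_cofinite[k Ik]].
  have ac : cofinite a by move=> m; apply: supported_cofinite.
  have [L [cL _]] := colength_cvg R n_ge1 le_order ga ac.
  have ca := mult_seq_cvg n_ge1 le_order ga ac cL.
  have ca' := mult_seq_initial_cvg n_ge1 le_order ga ac cL.
  split; first by apply/cvg_ex; eexists; apply: ca.
    by apply/cvg_ex; eexists; apply: ca'.
  by rewrite /asymptotic_mult (cvg_lim _ ca) // (cvg_lim _ ca').
have gI := graded_ideal_exp I; have cI := cofinite_ideal_exp Ik.
have [L [cL _]] := colength_cvg R n_ge1 le_order gI cI.
(* By [mult_cvg], the multiplicity of [I] is the limit of the same colengths that define [L]. *)
have -> : mult R I = n`!%:R * L.
  rewrite -(cvg_lim _ (mult_cvg n_ge1 le_order Ii Ik)) //.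
  exact: (cvg_lim _ (cvg_scale cL)).
exact: mult_seq_initial_cvg cL.
Qed.
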